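(* Let $N\in\mathbb N$, $N\ge 2$, and let $f_0\in\mathcal A_u(B_{\ell_2})$ be given by $f_0(x)=\sum_{j=1}^\infty x_j^N$. Then for every $g\in\mathcal H^\infty(B_{\ell_2},\ell_2)$ with $\|g\|<1$ the vector-valued cluster set $\mathcal{C\ell}(f_0,g)$ contains an analytic copy of the open unit ball $B_{\mathcal H^\infty(B_{\ell_2})}$ of $\mathcal H^\infty(B_{\ell_2})$.
   Context: All spaces are complex and $B_{\ell_2}$ is the open unit ball of $\ell_2$. $\mathcal A_u(B_{\ell_2})$ is the Banach algebra (sup norm) of holomorphic functions $f:B_{\ell_2}\to\mathbb C$ that are uniformly continuous on $B_{\ell_2}$. $\mathcal H^\infty(B_{\ell_2})$ is the Banach algebra of bounded holomorphic functions $B_{\ell_2}\to\mathbb C$ with the sup norm; $\mathcal H^\infty(B_{\ell_2},\ell_2)$ is the Banach space of bounded holomorphic maps $B_{\ell_2}\to\ell_2$ with the sup norm, and $B_{\mathcal H^\infty(B_{\ell_2},\ell_2)}$ is its open unit ball. Vector-valued cluster set: for $f\in\mathcal A_u(B_{\ell_2})$ and $g$ in the closed unit ball of $\mathcal H^\infty(B_{\ell_2},\ell_2)$, $\mathcal{C\ell}(f,g)$ is the set of all $h\in\mathcal H^\infty(B_{\ell_2})$ for which there is a net $(g_\alpha)\subset B_{\mathcal H^\infty(B_{\ell_2},\ell_2)}$ with $g_\alpha\xrightarrow{w^*}g$ and $f(g_\alpha(y))\to h(y)$ for all $y\in B_{\ell_2}$. Here $g_\alpha\xrightarrow{w^*}g$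 (weak-star convergence in $\mathcal H^\infty(B_{\ell_2},\ell_2)$ as a dual space) means, for such nets in the unit ball, that $\langle g_\alpha(y),v\rangle\to\langle g(y),v\rangle$ for all $y\in B_{\ell_2}$ and $v\in\ell_2$. For an open subset $U$ of a complex Banach space, $\mathcal{C\ell}(f,g)$ contains an analytic copy of $U$ if there is an injective map $F:U\to\mathcal H^\infty(B_{\ell_2})$ with $F(U)\subset\mathcal{C\ell}(f,g)$ such that $u\mapsto F(u)(x)$ is holomorphic on $U$ for every $x\in B_{\ell_2}$. *)

(* Defs.v *)
From HB Require Import structures.
From mathcomp Require Import all_boot all_order all_algebra.
From mathcomp Require Import complex ring lra.
From mathcomp Require Import all_classical all_reals all_analysis.

Set Implicit Arguments.
Unset Strict Implicit.
Unset Printing Implicit Defensive.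

Import Order.TTheory GRing.Theory Num.Theory.
Import numFieldNormedType.Exports.

Local Open Scope classical_set_scope.
Local Open Scope complex_scope.
Local Open Scope ring_scope.

(* The usual modulus topology on the complex numbers R[i]. *)
HB.instance Definition _ (R : realType) := NormedModule.copy R[i] R[i]^o.

Section real_norm.
Context {R : realType} {V : normedModType R[i]}.
Implicit Types x y : V.

(* Norms over the field R[i] are elements of R[i]; rnorm is the same number
   viewed in R, where suprema and square roots live. *)
Definition rnorm x : R := complex.Re `|x|.

Lemma rnormE x : (rnorm x)%:C = `|x|.
Proof. by rewrite /rnorm RRe_real// normr_real. Qed.

Lemma rnorm_ge0 x : 0 <= rnorm x.
Proof. by rewrite -ler0c rnormE. Qed.

Lemma rnorm0 : rnorm (0 : V) = 0.
Proof. by rewrite /rnorm normr0. Qed.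

Lemma rnorm0_eq0 x : rnorm x = 0 -> x = 0.
Proof. by move=> x0; apply: normr0_eq0; rewrite -rnormE x0. Qed.

Lemma ler_rnormD x y : rnorm (x + y) <= rnorm x + rnorm y.
Proof. by rewrite -lecR rmorphD/= !rnormE ler_normD. Qed.

End real_norm.

Lemma rnormZ {R : realType} {V : normedModType R[i]} (a : R[i]) (x : V) :
  rnorm (a *: x) = rnorm a * rnorm x.
Proof. by apply: complexI; rewrite rmorphM/= !rnormE normrZ. Qed.

Section ell2.
Context {R : realType}.
Local Notation C := R[i].
Implicit Types x y : nat -> C.

Definition sq_series x : R^nat := series (fun j => rnorm (x j) ^+ 2).

Definition ell2_pred : {pred (nat -> C)} := [pred x | `[< cvgn (sq_series x) >]].

Lemma sq_series_ge0 x n : 0 <= sq_series x n.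
Proof. by apply: sumr_ge0 => j _; apply: sqr_ge0. Qed.

Lemma sq_series_nd x : nondecreasing_seq (sq_series x).
Proof.
by apply/nondecreasing_seqP => n; rewrite /sq_series seriesSr lerDl sqr_ge0.
Qed.

Lemma sq_series_le_lim x n : cvgn (sq_series x) ->
  sq_series x n <= limn (sq_series x).
Proof. by move=> cx; apply: nondecreasing_cvgn_le => //; exact: sq_series_nd. Qed.

Lemma sq_series_bounded x (M : R) : (forall n, sq_series x n <= M) ->
  cvgn (sq_series x) /\ limn (sq_series x) <= M.
Proof.
move=> xM; have cx : cvgn (sq_series x).
  apply: nondecreasing_is_cvgn; first exact: sq_series_nd.
  by exists M => _ [n _ <-].
by split=> //; apply: limr_le => //; apply: nearW.
Qed.

Lemma minkowski2 (a b p q : R) : 0 <= a -> 0 <= b -> 0 <= p -> 0 <= q ->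
  (Num.sqrt a + Num.sqrt b) ^+ 2 + (p + q) ^+ 2 <=
  (Num.sqrt (a + p ^+ 2) + Num.sqrt (b + q ^+ 2)) ^+ 2.
Proof.
move=> a0 b0 p0 q0.
have ap : 0 <= a + p ^+ 2 by rewrite addr_ge0 ?sqr_ge0.
have bq : 0 <= b + q ^+ 2 by rewrite addr_ge0 ?sqr_ge0.
rewrite !sqrrD !sqr_sqrtr//.
set s : R := Num.sqrt a; set t : R := Num.sqrt b.
have sa : s ^+ 2 = a by rewrite sqr_sqrtr.
have tb : t ^+ 2 = b by rewrite sqr_sqrtr.
have s0 : 0 <= s by exact: sqrtr_ge0.
have t0 : 0 <= t by exact: sqrtr_ge0.
have cs : s * t + p * q <= Num.sqrt ((a + p ^+ 2) * (b + q ^+ 2)).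
  rewrite -[leLHS]ger0_norm ?addr_ge0 ?mulr_ge0// -sqrtr_sqr ler_wsqrtr//.
  rewrite -sa -tb -subr_ge0.
  have -> : (s ^+ 2 + p ^+ 2) * (t ^+ 2 + q ^+ 2) - (s * t + p * q) ^+ 2
            = (s * q - p * t) ^+ 2.
    by ring.
  exact: sqr_ge0.
rewrite sqrtrM// in cs; lra.
Qed.

Lemma sq_series_minkowski x y n :
  sq_series (x + y) n <= (Num.sqrt (sq_series x n) + Num.sqrt (sq_series y n)) ^+ 2.
Proof.
elim: n => [|n IH].
  by rewrite /sq_series /series/= !big_geq// sqr_ge0.
rewrite /sq_series !seriesSr -!/(sq_series _).
apply: le_trans (minkowski2 _ _ _ _); rewrite ?sq_series_ge0 ?rnorm_ge0//.
apply: lerD => //.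
by rewrite ler_pXn2r ?nnegrE ?addr_ge0 ?rnorm_ge0// ler_rnormD.
Qed.

Lemma sq_series_scale (a : C) x :
  sq_series (a *: x) = (fun n => (rnorm a) ^+ 2 * sq_series x n).
Proof.
apply/funext => n; rewrite /sq_series /series/= mulr_sumr.
by apply: eq_bigr => j _; rewrite rnormZ exprMn.
Qed.

Lemma sq_series_add x y : cvgn (sq_series x) -> cvgn (sq_series y) ->
  cvgn (sq_series (x + y)) /\
  limn (sq_series (x + y)) <=
    (Num.sqrt (limn (sq_series x)) + Num.sqrt (limn (sq_series y))) ^+ 2.
Proof.
move=> cx cy; apply: sq_series_bounded => n.
apply: le_trans (sq_series_minkowski x y n) _.
rewrite ler_pXn2r ?nnegrE ?addr_ge0 ?sqrtr_ge0//.
by apply: lerD; apply: ler_wsqrtr; apply: sq_series_le_lim.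
Qed.

Lemma ell2_submod : submod_closed ell2_pred.
Proof.
split.
  apply/asboolP; apply: (proj1 (@sq_series_bounded 0 0 _)) => n; rewrite /sq_series /series/= big1// => j _.
  by rewrite [X in rnorm X](_ : _ = 0)// rnorm0 expr0n.
move=> a x y /asboolP cx /asboolP cy; apply/asboolP.
apply: (sq_series_add _ cy).1; rewrite sq_series_scale.
exact: is_cvgMr.
Qed.

HB.instance Definition _ := GRing.isSubmodClosed.Build C _ ell2_pred ell2_submod.

Record ell2 := Ell2 { ell2_seq :> nat -> C ; _ : ell2_seq \in ell2_pred }.

HB.instance Definition _ := [isSub for ell2_seq].
HB.instance Definition _ := [Choice of ell2 by <:].
HB.instance Definition _ := [SubChoice_isSubLmodule of ell2 by <:].

Definition ell2_norm (x : ell2) : C := (Num.sqrt (limn (sq_series x)))%:C.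

Lemma ell2_cvg (x : ell2) : cvgn (sq_series x).
Proof. by case: x => x xP; apply/asboolP. Qed.
Arguments ell2_cvg : clear implicits.

Lemma ell2_normD (x y : ell2) : ell2_norm (x + y) <= ell2_norm x + ell2_norm y.
Proof.
rewrite -rmorphD/= lecR.
have [_] := sq_series_add (ell2_cvg x) (ell2_cvg y).
by move=> /ler_wsqrtr; rewrite sqrtr_sqr ger0_norm// addr_ge0 ?sqrtr_ge0.
Qed.

Lemma ell2_normZ (a : C) (x : ell2) : ell2_norm (a *: x) = `|a| * ell2_norm x.
Proof.
rewrite /ell2_norm [ell2_seq _](_ : _ = a *: (x : nat -> C))// sq_series_scale.
have -> : limn (fun n => rnorm a ^+ 2 * sq_series x n) =
          rnorm a ^+ 2 * limn (sq_series x).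
  by apply/cvg_lim => //; apply: cvgMr; exact: ell2_cvg.
by rewrite sqrtrM ?sqr_ge0// sqrtr_sqr rmorphM/= ger0_norm ?rnorm_ge0// rnormE.
Qed.

Lemma ell2_norm0_eq0 (x : ell2) : ell2_norm x = 0 -> x = 0.
Proof.
move=> /complexI /eqP; rewrite sqrtr_eq0 => l0.
apply/val_inj/funext => j; apply: rnorm0_eq0.
apply/eqP; rewrite -sqrf_eq0; apply/eqP/le_anti; rewrite sqr_ge0 andbT.
apply: le_trans l0; apply: le_trans (sq_series_le_lim j.+1 (ell2_cvg x)).
by rewrite /sq_series seriesSr lerDr; exact: sq_series_ge0.
Qed.

HB.instance Definition _ :=
  Lmodule_isNormed.Build C ell2 ell2_normD ell2_normZ ell2_norm0_eq0.

(* Both series below converge absolutely on ell2 (the second one for N >= 2), so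
   that limn is their actual sum. *)
Definition inner (x y : ell2) : C := limn (series (fun j => x j * (y j)^*)).

Definition power_sum (N : nat) (x : ell2) : C := limn (series (fun j => x j ^+ N)).

End ell2.
Arguments ell2 R : clear implicits.

Definition unit_ball {R : realType} (E : normedModType R[i]) : set E :=
  [set x | `|x| < 1].
Arguments unit_ball {R} E.

Definition holomorphic_on {R : realType} {E V : normedModType R[i]}
  (U : set E) (f : E -> V) : Prop := forall x, U x -> differentiable f x.

Section Hinf.
Context {R : realType} (E V : normedModType R[i]).
Local Notation C := R[i].
Implicit Types f g : E -> V.

Definition bounded_on_ball f := exists M : R, forall x, unit_ball E x -> rnorm (f x) <= M.

(* A map on the unit ball is represented by its extension by 0 to E, so that
   equality of representatives is equality of maps on the ball. *)
Definition Hinf_pred : {pred (E -> V)} := [pred f | `[<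
  [/\ holomorphic_on (unit_ball E) f, bounded_on_ball f &
      forall x, ~ unit_ball E x -> f x = 0] >]].

Lemma Hinf_submod : submod_closed Hinf_pred.
Proof.
split.
  apply/asboolP; split=> //.
  by exists 0 => x _; rewrite [X in rnorm X](_ : _ = 0)// rnorm0.
move=> a f g /asboolP[df [M fM] f0] /asboolP[dg [K gK] g0]; apply/asboolP; split.
- move=> x Bx; apply: differentiableD; last exact: dg.
  by apply: differentiableZ; exact: df.
- exists (rnorm a * M + K) => x Bx.
  apply: le_trans (ler_rnormD _ _) _; apply: lerD; last exact: gK.
  by rewrite rnormZ ler_wpM2l ?fM ?rnorm_ge0.
- by move=> x Bx; rewrite !fctE f0// g0// scaler0 addr0.
Qed.

HB.instance Definition _ := GRing.isSubmodClosed.Build C _ Hinf_pred Hinf_submod.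

Record Hinf := MkHinf { Hinf_fun :> E -> V ; _ : Hinf_fun \in Hinf_pred }.

HB.instance Definition _ := [isSub for Hinf_fun].
HB.instance Definition _ := [Choice of Hinf by <:].
HB.instance Definition _ := [SubChoice_isSubLmodule of Hinf by <:].

Definition Hinf_values (f : Hinf) : set R := [set rnorm (f x) | x in unit_ball E].

Definition Hinf_norm (f : Hinf) : C := (sup (Hinf_values f))%:C.

Lemma Hinf_has_sup (f : Hinf) : has_sup (Hinf_values f).
Proof.
split; first by exists (rnorm (f 0)), 0 => //; rewrite /unit_ball/= normr0.
case: f => f fP; have /asboolP[_ [M fM] _] := fP; exists M => _ [x Bx <-]; exact: fM.
Qed.

Lemma Hinf_le_sup (f : Hinf) x : unit_ball E x -> rnorm (f x) <= sup (Hinf_values f).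
Proof. by move=> Bx; apply: (sup_upper_bound (Hinf_has_sup f)); exists x. Qed.

Lemma Hinf_sup_le (f : Hinf) (M : R) :
  (forall x, unit_ball E x -> rnorm (f x) <= M) -> sup (Hinf_values f) <= M.
Proof.
by move=> fM; apply: ge_sup; [case: (Hinf_has_sup f)|move=> _ [x /fM ? <-]].
Qed.

Lemma Hinf_normD (f g : Hinf) : Hinf_norm (f + g) <= Hinf_norm f + Hinf_norm g.
Proof.
rewrite -rmorphD/= lecR; apply: Hinf_sup_le => x Bx.
by apply: le_trans (ler_rnormD _ _) _; apply: lerD; exact: Hinf_le_sup.
Qed.

Lemma Hinf_norm0_eq0 (f : Hinf) : Hinf_norm f = 0 -> f = 0.
Proof.
move=> /complexI f0; apply/val_inj/funext => x.
have [Bx|Bx] := pselect (unit_ball E x).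
  apply: rnorm0_eq0; apply/le_anti; rewrite rnorm_ge0 andbT -f0.
  exact: Hinf_le_sup.
by case: f {f0} => f fP; have /asboolP[_ _ f0] := fP; rewrite /= f0.
Qed.

Lemma Hinf_normZ (a : C) (f : Hinf) : Hinf_norm (a *: f) = `|a| * Hinf_norm f.
Proof.
have le_a b (g : Hinf) : sup (Hinf_values (b *: g)) <= rnorm b * sup (Hinf_values g).
  by apply: Hinf_sup_le => x Bx; rewrite rnormZ ler_wpM2l ?Hinf_le_sup ?rnorm_ge0.
have [->|a0] := eqVneq a 0.
  rewrite normr0 mul0r; congr (_%:C); apply/le_anti/andP; split.
    by have := le_a 0 f; rewrite rnorm0 mul0r.
  apply: le_trans (rnorm_ge0 _) (@Hinf_le_sup _ 0 _).
  by rewrite /unit_ball/= normr0.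
have pa : 0 < rnorm a by rewrite -ltcR rnormE normr_gt0.
rewrite /Hinf_norm -[`|a|]rnormE -rmorphM /=; congr (_%:C).
apply/le_anti; rewrite le_a/=.
have := le_a a^-1 (a *: f); rewrite scalerA mulVf// scale1r.
have -> : rnorm a^-1 = (rnorm a)^-1.
  by apply: complexI; rewrite fmorphV/= !rnormE normfV.
by rewrite ler_pdivlMl.
Qed.

HB.instance Definition _ :=
  Lmodule_isNormed.Build C Hinf Hinf_normD Hinf_normZ Hinf_norm0_eq0.

End Hinf.

(* A_u(B) as a predicate on maps of ell2: the values of f outside the open
   ball are irrelevant, here and in vector_cluster_set. *)
Definition Au {R : realType} (f : ell2 R -> R[i]) : Prop :=
  holomorphic_on (unit_ball (ell2 R)) f /\
  forall e : R, 0 < e -> exists2 d : R, 0 < d &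
    forall x y, unit_ball (ell2 R) x -> unit_ball (ell2 R) y ->
      rnorm (x - y) < d -> rnorm (f x - f y) < e.

Definition directed {I : Type} (le : I -> I -> Prop) : Prop :=
  [/\ inhabited I, forall a, le a a,
      forall a b c, le a b -> le b c -> le a c &
      forall a b, exists2 c, le a c & le b c].

(* The filter of tails of a net: u @ tails le --> l is convergence of the net u. *)
Definition tails {I : Type} (le : I -> I -> Prop) : set_system I :=
  [set A | exists a, forall b, le a b -> A b].

Section cluster_set.
Context {R : realType}.
Local Notation C := R[i].
Local Notation l2 := (ell2 R).

(* Weak-star convergence in H^oo(B, l2) is only used for nets in the unit ball,
   where it is the pointwise weak convergence below. *)
Definition weakstar_cvg {I : Type} (le : I -> I -> Prop)
    (G : I -> Hinf l2 l2) (g : Hinf l2 l2) : Prop :=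
  forall (y v : l2), unit_ball l2 y ->
    (fun a => inner (G a y) v) @ tails le --> inner (g y) v.

Definition vector_cluster_set (f : l2 -> C) (g : Hinf l2 l2) : set (Hinf l2 C) :=
  [set h | exists (I : Type) (le : I -> I -> Prop) (G : I -> Hinf l2 l2),
    [/\ directed le, forall a, `|G a| < 1, weakstar_cvg le G g &
        forall y, unit_ball l2 y ->
          (fun a => f (G a y)) @ tails le --> h y]].

(* F is only constrained on U: its values outside U play no role. *)
Definition contains_analytic_copy {X : normedModType C} (U : set X)
    (S : set (Hinf l2 C)) : Prop :=
  exists F : X -> Hinf l2 C,
    [/\ {in U &, injective F}, F @` U `<=` S &
        forall x, unit_ball l2 x -> holomorphic_on U (fun u => F u x)].

End cluster_set.

(* Main.v *)
(* Write e_n for the n-th unit vector of ell2, and fix small constants c, e > 0.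
   For u in the unit ball of H^oo(B) put w = c (1 + e u) and
     G_n(y) = (g_0(y), ..., g_(n-1)(y), w(y), 0, 0, ...).
   With c = (1 - |g|) / 4 every G_n lies in the open unit ball. Since the bump
   w e_n tends weakly to 0, G_n tends to g, while the power sums do see it:
     f_0(G_n(y)) --> f_0(g(y)) + w(y)^N =: F(u)(y).
   Clearly F is analytic in u. It is injective because 1 + e u takes values in
   a disc around 1 on which, for e = 1 / (2 N), z |-> z^N is injective: there
   p^N - q^N = (p - q) S where S is a sum of N numbers close to 1. *)
From HB Require Import structures.
Require Import Defs.
From mathcomp Require Import all_boot all_order all_algebra.
From mathcomp Require Import complex ring lra.
From mathcomp Require Import all_classical all_reals all_analysis.

Set Implicit Arguments.
Unset Strict Implicit.
Unset Printing Implicit Defensive.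

Import Order.TTheory GRing.Theory Num.Theory.
Import numFieldNormedType.Exports.

Local Open Scope classical_set_scope.
Local Open Scope complex_scope.
Local Open Scope ring_scope.

(** * Differentiability of bounded linear and bilinear maps *)

Section bounded_maps.
Context {K : numFieldType} {E U V W : normedModType K}.

Lemma bounded_linear_differentiable (L : U -> V) (k : K) (x : U) :
  0 <= k -> linear L -> (forall u, `|L u| <= k * `|u|) -> differentiable L x.
Proof.
move=> k0 linL Lk.
pose LL : {linear U -> V} := HB.pack L (GRing.isLinear.Build _ _ _ _ L linL).
rewrite -[L]/(LL : U -> V); apply: linear_differentiable.
apply: bounded_linear_continuous; apply/linear_boundedP.
exists k; split; first exact: ger0_real.
by move=> r kr u; apply: le_trans (Lk u) _; rewrite ler_wpM2r// ltW.
Qed.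

(** The increment splits as b(q1 - p1, q2) + b(p1, q2 - p2), and |q2| <= |p2| + 1 near p, so both
    terms are small. *)
Lemma bounded_bilinear_continuous (b : U -> V -> W) (k : K) :
  0 <= k -> (forall v, linear (b^~ v)) -> (forall u, linear (b u)) ->
  (forall u v, `|b u v| <= k * `|u| * `|v|) ->
  continuous (fun p : U * V => b p.1 p.2).
Proof.
move=> k0 linl linr bk p; apply/cvgrPdistC_lt => e e0.
set s : K := `|p.2| + 1 + `|p.1|.
have s0 : 0 <= s by rewrite !addr_ge0.
(* The two terms together are at most [k * s] times this radius; the added 1 covers [k = 0] and
   makes the final inequality strict. *)
have d0 : 0 < e / (1 + k * s) by rewrite divr_gt0// ltr_pwDl// mulr_ge0.
near=> q.
have q1 : `|q.1 - p.1| < e / (1 + k * s).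
  near: q; apply: (@cvgr_distC_lt _ _ _ _ _ (fun q : U * V => q.1) p.1) => //.
  exact: cvg_fst.
have q2 : `|q.2 - p.2| < e / (1 + k * s).
  near: q; apply: (@cvgr_distC_lt _ _ _ _ _ (fun q : U * V => q.2) p.2) => //.
  exact: cvg_snd.
have q3 : `|q.2 - p.2| < 1.
  near: q; apply: (@cvgr_distC_lt _ _ _ _ _ (fun q : U * V => q.2) p.2) => //.
  exact: cvg_snd.
have q4 : `|q.2| <= `|p.2| + 1.
  by rewrite -[q.2](subrKC p.2) (le_trans (ler_normD _ _))// lerD2l ltW.
have -> : b q.1 q.2 - b p.1 p.2 = b (q.1 - p.1) q.2 + b p.1 (q.2 - p.2).
  have -> : b (q.1 - p.1) q.2 = b q.1 q.2 - b p.1 q.2.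
    exact: (zmod_morphism_linear (linl q.2)).
  have -> : b p.1 (q.2 - p.2) = b p.1 q.2 - b p.1 p.2.
    exact: (zmod_morphism_linear (linr p.1)).
  by rewrite addrA subrK.
apply: le_lt_trans (ler_normD _ _) _.
apply: (@le_lt_trans _ _ (e / (1 + k * s) * (k * s))).
  rewrite -[X in _ * (k * X)]/(`|p.2| + 1 + `|p.1|).
  rewrite [X in _ * X]mulrDr [leRHS]mulrDr lerD//.
    apply: le_trans (bk _ _) _.
    rewrite [leRHS]mulrCA -[leLHS]mulrA ler_wpM2l//.
    by rewrite ler_pM// ltW.
  apply: le_trans (bk _ _) _.
  by rewrite mulrC ler_wpM2r ?mulr_ge0// ltW.
have ks0 : 0 <= k * s by rewrite mulr_ge0.
by rewrite mulrAC ltr_pdivrMr ?ltr_pwDl// ltr_pM2l// ltrDr.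
Unshelve. all: by end_near. Qed.

(** Chain rule through the pair (f, g). Every product below is handled this way: coordinatewise
    products, the pairing [dot], scalar multiplication and products of functions. *)
Lemma bounded_bilinear_differentiable (b : U -> V -> W) (k : K)
    (f : E -> U) (g : E -> V) (x : E) :
  0 <= k -> (forall v, linear (b^~ v)) -> (forall u, linear (b u)) ->
  (forall u v, `|b u v| <= k * `|u| * `|v|) ->
  differentiable f x -> differentiable g x ->
  differentiable (fun y => b (f y) (g y)) x.
Proof.
move=> k0 linl linr bk df dg.
have bil : bilinear_for (GRing.Scale.Law.clone _ _ *:%R _)
    (GRing.Scale.Law.clone _ _ *:%R _) b by split.
pose bb : {bilinear U -> V -> W} :=
  HB.pack b (bilinear_isBilinear.Build _ _ _ _ _ _ b bil).
have -> : (fun y => b (f y) (g y)) =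
    (fun p : U * V => bb p.1 p.2) \o (fun y => (f y, g y)) by [].
apply: differentiable_comp; first exact: differentiable_pair.
apply: differentiable_bilin; exact: bounded_bilinear_continuous bk.
Qed.

End bounded_maps.

(** * Complex series dominated by real ones *)

Section dominated_series.
Context {R : realType}.
Local Notation C := R[i].

Lemma Re_le_norm (z : C) : `|complex.Re z| <= complex.Re `|z|.
Proof.
case: z => a b /=; rewrite -sqrtr_sqr ler_wsqrtr// lerDl sqr_ge0//.
Qed.

Lemma Im_le_norm (z : C) : `|complex.Im z| <= complex.Re `|z|.
Proof.
case: z => a b /=; rewrite -sqrtr_sqr ler_wsqrtr// lerDr sqr_ge0//.
Qed.

Lemma norm_le_ReIm (z : C) : `|z| <= (`|complex.Re z| + `|complex.Im z|)%:C.
Proof.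
rewrite normc_def lecR -[leRHS]ger0_norm ?addr_ge0// -sqrtr_sqr ler_wsqrtr//.
by rewrite sqrrD !real_normK ?num_real// lerD2r lerDl mulrn_wge0// mulr_ge0.
Qed.

Lemma cvg_complex (u : C^nat) (a b : R) :
  (@complex.Re R \o u) @ \oo --> a -> (@complex.Im R \o u) @ \oo --> b ->
  u @ \oo --> (a +i* b).
Proof.
move=> ua ub; apply/cvgrPdistC_lt => e e0.
have er : e = (complex.Re e)%:C by rewrite RRe_real// gtr0_real.
have e0' : 0 < complex.Re e / 2 by rewrite divr_gt0// -ltcR -er.
near=> n.
apply: le_lt_trans (norm_le_ReIm _) _; rewrite er ltcR.
have u1 : `|complex.Re (u n) - a| < complex.Re e / 2.
  near: n; exact: (@cvgr_distC_lt _ _ _ _ _ (@complex.Re R \o u) a).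
have u2 : `|complex.Im (u n) - b| < complex.Re e / 2.
  near: n; exact: (@cvgr_distC_lt _ _ _ _ _ (@complex.Im R \o u) b).
have := ltrD u1 u2; rewrite -splitr.
by case: (u n).
Unshelve. all: by end_near. Qed.

Lemma cvgn_rnorm_le (u : C^nat) (l : C) (M : R) :
  u @ \oo --> l -> (forall n, rnorm (u n) <= M) -> rnorm l <= M.
Proof.
move=> ul uM; apply/ler_addgt0Pr => e e0.
have : \forall n \near \oo, `|l - u n| < e%:C.
  by apply: (@cvgr_dist_lt _ _ _ _ _ u l) => //; rewrite ltcR.
move=> [n _ /(_ n (leqnn n)) /=]; rewrite -rnormE ltcR => len.
rewrite -(subrK (u n) l) (le_trans (ler_rnormD _ _))// addrC lerD// ltW//.
Qed.

(** The real and imaginary parts are dominated by the convergent series of [b], so each converges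
    absolutely; the bound passes from the partial sums to the limit. *)
Lemma dominated_series (a : C^nat) (b : R^nat) (M : R) :
  (forall j, rnorm (a j) <= b j) -> (forall n, series b n <= M) ->
  cvgn (series a) /\ rnorm (limn (series a)) <= M.
Proof.
move=> ab bM.
have b0 j : 0 <= b j by apply: le_trans (ab j); exact: rnorm_ge0.
have cb : cvgn (series b).
  apply: nondecreasing_is_cvgn; last by exists M => _ [n _ <-].
  by apply/nondecreasing_seqP => n; rewrite seriesSr lerDl.
have part (f : C -> R) :
    (forall z, `|f z| <= rnorm z) -> cvgn (series (f \o a)).
  move=> fle; apply: normed_cvg; apply: series_le_cvg cb => //= n.
  exact: le_trans (fle _) (ab n).
have ca : series a @ \oo -->
    (limn (series (@complex.Re R \o a)) +i*
     limn (series (@complex.Im R \o a))).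
  apply: cvg_complex.
    have -> : @complex.Re R \o series a = series (@complex.Re R \o a).
      by apply/funext => n; rewrite /series/= (raddf_sum (@complex.Re R)).
    exact: part Re_le_norm.
  have -> : @complex.Im R \o series a = series (@complex.Im R \o a).
    by apply/funext => n; rewrite /series/= (raddf_sum (@complex.Im R)).
  exact: part Im_le_norm.
have cva : cvgn (series a) by apply/cvg_ex; eexists; exact: ca.
split=> //; apply: (cvgn_rnorm_le cva) => n; apply: le_trans (bM n).
rewrite /series/=; elim/big_ind2 : _ => //; first by rewrite rnorm0.
by move=> x1 x2 y1 y2 h1 h2; rewrite (le_trans (ler_rnormD _ _))// lerD.
Qed.

End dominated_series.


(** * Cauchy-Schwarz, a bilinear pairing and the coordinatewise product on ell2 *)

Section ell2_operations.
Context {R : realType}.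
Local Notation C := R[i].
Local Notation l2 := (ell2 R).
Implicit Types x y z : l2.

Lemma rnormM (a b : C) : rnorm (a * b) = rnorm a * rnorm b.
Proof. exact: rnormZ. Qed.

Lemma rnormX (a : C) n : rnorm (a ^+ n) = rnorm a ^+ n.
Proof.
elim: n => [|n IH]; last by rewrite !exprS rnormM IH.
by rewrite !expr0 /rnorm normr1.
Qed.

Lemma rnorm_ell2E x : rnorm x = Num.sqrt (limn (sq_series x)).
Proof. by []. Qed.

Lemma sqr_rnorm_ell2 x : rnorm x ^+ 2 = limn (sq_series x).
Proof.
rewrite rnorm_ell2E sqr_sqrtr//.
by apply: le_trans (sq_series_le_lim 0 (@ell2_cvg _ x)); exact: sq_series_ge0.
Qed.

Lemma sq_series_le_rnorm x n : sq_series x n <= rnorm x ^+ 2.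
Proof. by rewrite sqr_rnorm_ell2; exact/sq_series_le_lim/ell2_cvg. Qed.

Lemma coord_le_rnorm x j : rnorm (x j) <= rnorm x.
Proof.
rewrite -ler_sqr ?nnegrE ?rnorm_ge0//.
apply: le_trans (sq_series_le_rnorm x j.+1).
by rewrite /sq_series seriesSr lerDr; exact: sq_series_ge0.
Qed.

Lemma ell2_pred_le (f : nat -> C) (M : R) :
  (forall n, sq_series f n <= M) -> f \in ell2_pred.
Proof. by move=> /sq_series_bounded[cf _]; apply/asboolP. Qed.

Lemma rnorm_ell2_le x (M : R) :
  0 <= M -> (forall n, sq_series x n <= M ^+ 2) -> rnorm x <= M.
Proof.
move=> M0 /sq_series_bounded[_ xM].
by rewrite -ler_sqr ?nnegrE ?rnorm_ge0// sqr_rnorm_ell2.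
Qed.

(** Cauchy-Schwarz in the plane for (sqrt a, p) and (sqrt b, q), from the Lagrange identity; it adds
    one coordinate in the induction for [cauchy_schwarz]. *)
Lemma cauchy_schwarz_step (a b p q : R) :
  0 <= a -> 0 <= b -> 0 <= p -> 0 <= q ->
  Num.sqrt a * Num.sqrt b + p * q <=
  Num.sqrt (a + p ^+ 2) * Num.sqrt (b + q ^+ 2).
Proof.
move=> a0 b0 p0 q0; rewrite -[leRHS]sqrtrM ?addr_ge0 ?sqr_ge0//.
rewrite -[leLHS]ger0_norm ?addr_ge0 ?mulr_ge0 ?sqrtr_ge0//.
rewrite -sqrtr_sqr ler_wsqrtr//.
set s := Num.sqrt a; set t := Num.sqrt b.
rewrite -[a]sqr_sqrtr// -[b]sqr_sqrtr// -/s -/t -subr_ge0.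
have -> : (s ^+ 2 + p ^+ 2) * (t ^+ 2 + q ^+ 2) - (s * t + p * q) ^+ 2
          = (s * q - p * t) ^+ 2 by ring.
exact: sqr_ge0.
Qed.

Lemma cauchy_schwarz x y n :
  series (fun j => rnorm (x j) * rnorm (y j)) n <= rnorm x * rnorm y.
Proof.
apply: (@le_trans _ _ (Num.sqrt (sq_series x n) * Num.sqrt (sq_series y n))).
  elim: n => [|n IH].
    by rewrite /series/= big_geq// mulr_ge0 ?sqrtr_ge0.
  rewrite seriesSr (le_trans (lerD IH (lexx _)))// /sq_series !seriesSr.
  by apply: cauchy_schwarz_step; rewrite ?rnorm_ge0 ?sq_series_ge0.
have le_rnorm z : Num.sqrt (sq_series z n) <= rnorm z.
  rewrite -ler_sqr ?nnegrE ?rnorm_ge0 ?sqrtr_ge0// sqr_sqrtr ?sq_series_ge0//.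
  exact: sq_series_le_rnorm.
by apply: ler_pM; rewrite ?sqrtr_ge0.
Qed.

(** Unlike [inner], there is no conjugation: the pairing is complex linear in both arguments and so
    preserves holomorphy. *)
Definition dot x y : C := limn (series (fun j => x j * y j)).

Lemma dot_cvg_le x y : cvgn (series (fun j => x j * y j)) /\
  rnorm (dot x y) <= rnorm x * rnorm y.
Proof.
apply: (@dominated_series _ _ (fun j => rnorm (x j) * rnorm (y j))).
  by move=> j; rewrite rnormM.
exact: cauchy_schwarz.
Qed.

Lemma dotC x y : dot x y = dot y x.
Proof.
by rewrite /dot; congr (limn (series _)); apply/funext => j; rewrite mulrC.
Qed.

Lemma dot_linear x : linear (dot x).
Proof.
move=> a y z; apply/cvg_lim => //.
have -> : series (fun j => x j * (a *: y + z : l2) j) =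
    (fun n => a * series (fun j => x j * y j) n) +
    series (fun j => x j * z j).
  apply/funext => n; rewrite !fctE /series/= mulr_sumr -big_split/=.
  apply: eq_bigr => j _.
  by rewrite [LHS](_ : _ = x j * (a * y j + z j))//; ring.
by apply: cvgD; [apply: cvgMr|]; exact: (dot_cvg_le _ _).1.
Qed.

(** Each |x_j| is at most |x|, so the j-th term is at most |x|^2 |y_j|^2. *)
Lemma sq_series_pmul_le x y n :
  sq_series (fun j => x j * y j) n <= (rnorm x * rnorm y) ^+ 2.
Proof.
rewrite exprMn (le_trans _ (ler_wpM2l (sqr_ge0 _) (sq_series_le_rnorm y n)))//.
rewrite /sq_series /series/= mulr_sumr ler_sum// => j _.
rewrite rnormM exprMn ler_wpM2r ?sqr_ge0//.
by rewrite ler_sqr ?nnegrE ?rnorm_ge0// coord_le_rnorm.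
Qed.

Lemma pmul_subproof x y : (fun j => x j * y j) \in @ell2_pred R.
Proof. exact: ell2_pred_le (sq_series_pmul_le x y). Qed.

Definition pmul x y : l2 := Ell2 (pmul_subproof x y).

Lemma pmul_le x y : rnorm (pmul x y) <= rnorm x * rnorm y.
Proof.
apply: rnorm_ell2_le; first by rewrite mulr_ge0 ?rnorm_ge0.
exact: sq_series_pmul_le.
Qed.

Lemma pmulC x y : pmul x y = pmul y x.
Proof. by apply/val_inj/funext => j /=; rewrite mulrC. Qed.

Lemma pmul_linear x : linear (pmul x).
Proof.
move=> a y z; apply/val_inj/funext => j.
rewrite [RHS](_ : _ = a * (x j * y j) + x j * z j)//.
rewrite [LHS](_ : _ = x j * (a * y j + z j))//; ring.
Qed.

End ell2_operations.

(** * Power sums are holomorphic and uniformly continuous on the ball *)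

Section power_sums.
Context {R : realType}.
Local Notation C := R[i].
Local Notation l2 := (ell2 R).
Implicit Types x y z : l2.

Lemma pmul_differentiable (E : normedModType C) (f g : E -> l2) (u : E) :
  differentiable f u -> differentiable g u ->
  differentiable (fun v => pmul (f v) (g v)) u.
Proof.
apply: (@bounded_bilinear_differentiable _ _ _ _ _ _ 1) => //.
- by move=> y a x z; rewrite pmulC pmul_linear !(pmulC y).
- exact: pmul_linear.
- by move=> x y; rewrite mul1r -!rnormE -rmorphM/= lecR pmul_le.
Qed.

Lemma dot_differentiable (E : normedModType C) (f g : E -> l2) (u : E) :
  differentiable f u -> differentiable g u ->
  differentiable (fun v => dot (f v) (g v)) u.
Proof.
apply: (@bounded_bilinear_differentiable _ _ _ _ _ _ 1) => //.
- by move=> y a x z; rewrite dotC dot_linear !(dotC y).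
- exact: dot_linear.
- by move=> x y; rewrite mul1r -!rnormE -rmorphM/= lecR (dot_cvg_le _ _).2.
Qed.

(* The coordinatewise power [x ^ (k + 1)]; the exponent 0 would leave ell2. *)
Definition ppow k x : l2 := iter k (fun z => pmul z x) x.

Lemma ppowE k x j : ppow k x j = x j ^+ k.+1.
Proof. by elim: k => //= k IH; rewrite IH -exprSr. Qed.

(** Exhibits the power sum as a composite of bounded bilinear maps, from which its differentiability
    and its estimates follow. *)
Lemma power_sumE k x : power_sum k.+2 x = dot (ppow k x) x.
Proof.
rewrite /power_sum /dot; congr (limn (series _)).
by apply/funext => j; rewrite ppowE -exprSr.
Qed.

Lemma ppow_differentiable k x : differentiable (ppow k) x.
Proof. by elim: k => [|k IH] //=; exact: pmul_differentiable. Qed.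

Lemma power_sum_differentiable k x : differentiable (@power_sum R k.+2) x.
Proof.
rewrite (_ : power_sum _ = fun x => dot (ppow k x) x).
  by apply: dot_differentiable => //; exact: ppow_differentiable.
exact/funext/power_sumE.
Qed.

Lemma unit_ballP (E : normedModType C) (u : E) : unit_ball E u <-> rnorm u < 1.
Proof. by rewrite /unit_ball/= -rnormE ltcR. Qed.

Lemma ppow_le1 k x : rnorm x <= 1 -> rnorm (ppow k x) <= 1.
Proof.
move=> x1; elim: k => //= k IH.
by rewrite (le_trans (pmul_le _ _))// mulr_ile1 ?rnorm_ge0.
Qed.

Lemma power_sum_le1 k x : rnorm x <= 1 -> rnorm (power_sum k.+2 x) <= 1.
Proof.
move=> x1; rewrite power_sumE (le_trans (dot_cvg_le _ _).2)//.
by rewrite mulr_ile1 ?rnorm_ge0// ppow_le1.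
Qed.

(** With coordinatewise powers, x^(k+2) - y^(k+2) = x^(k+1) (x - y) + y (x^(k+1) - y^(k+1)); on the
    closed unit ball each step adds at most one |x - y|. *)
Lemma ppow_lipschitz k x y : rnorm x <= 1 -> rnorm y <= 1 ->
  rnorm (ppow k x - ppow k y) <= k.+1%:R * rnorm (x - y).
Proof.
move=> x1 y1; elim: k => [|k IH]; first by rewrite mul1r.
rewrite [X in rnorm X](_ : _ =
  pmul (ppow k x) (x - y) + pmul y (ppow k x - ppow k y)).
  rewrite (le_trans (ler_rnormD _ _))// -natr1 addrC mulrDl mul1r lerD//.
    rewrite (le_trans (pmul_le _ _))//; apply: le_trans IH.
    by rewrite ler_piMl ?rnorm_ge0.
  by rewrite (le_trans (pmul_le _ _))// ler_piMl ?rnorm_ge0// ppow_le1.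
rewrite !(zmod_morphism_linear (pmul_linear _)) [pmul y (ppow k x)]pmulC.
by rewrite addrA subrK (pmulC y).
Qed.

Lemma power_sum_lipschitz k x y : rnorm x <= 1 -> rnorm y <= 1 ->
  rnorm (power_sum k.+2 x - power_sum k.+2 y) <= k.+2%:R * rnorm (x - y).
Proof.
move=> x1 y1; rewrite !power_sumE.
(* The same splitting as for [ppow], with [dot] as the last product. *)
rewrite [X in rnorm X](_ : _ =
  dot (ppow k x) (x - y) + dot y (ppow k x - ppow k y)).
  rewrite (le_trans (ler_rnormD _ _))// -natr1 addrC mulrDl mul1r lerD//.
    rewrite (le_trans (dot_cvg_le _ _).2)//.
    by rewrite (le_trans _ (ppow_lipschitz k x1 y1))// ler_piMl ?rnorm_ge0.
  by rewrite (le_trans (dot_cvg_le _ _).2)// ler_piMl ?rnorm_ge0// ppow_le1.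
rewrite !(zmod_morphism_linear (dot_linear _)) [dot y (ppow k x)]dotC.
by rewrite addrA subrK (dotC y).
Qed.

Lemma power_sum_Au k : Au (@power_sum R k.+2).
Proof.
split=> [x _|e e0]; first exact: power_sum_differentiable.
exists (e / k.+2%:R) => [|x y /unit_ballP/ltW x1 /unit_ballP/ltW y1].
  by rewrite divr_gt0.
rewrite ltr_pdivlMr// mulrC; exact/le_lt_trans/power_sum_lipschitz.
Qed.

End power_sums.

(** * Differentiability is a local property *)

Section local_differentiability.
Context {K : numFieldType} {E V : normedModType K}.

(** The difference g - f vanishes near x, so its derivative there is 0. This allows maps to be
    replaced by their extensions by zero. *)
Lemma near_eq_differentiable (f g : E -> V) (x : E) :
  (\forall y \near x, f y = g y) -> differentiable f x -> differentiable g x.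
Proof.
move=> fg df.
suff dh : differentiable (g - f) x.
  by rewrite -[g](subrKC f); exact: differentiableD.
have h0 : (g - f) \o shift x = cst ((g - f) x) + \0 +o_ (0 : E) id.
  apply/eqaddoP => _/posnumP[e]; near=> h.
  have -> : ((g - f) \o shift x - (cst ((g - f) x) + \0)) h = 0.
    rewrite !fctE /= addr0 (nbhs_singleton fg) subrr subr0.
    have -> : f (h + x) = g (h + x); last by rewrite subrr.
    near: h; have := fg; rewrite (near_shift 0) subr0.
    by apply: filterS => h; rewrite /= addrC.
  by rewrite normr0 mulr_ge0.
have d0 : 'd (g - f) x = \0 :> (E -> V).
  by apply: (diff_unique _ h0) => y; exact: cvg_cst.
by apply/diff_locallyP; rewrite d0; split => // y; exact: cvg_cst.
Unshelve. all: by end_near. Qed.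

End local_differentiability.

(** * Injectivity of powers near 1 *)

Section power_injectivity.
Context {K : numFieldType}.
Implicit Types (p q z e t : K).

(** Since |z| <= 2, an extra factor p costs at most 2 e. *)
Lemma mul_near1 p z e t : t <= 1 -> `|p - 1| <= e -> `|z - 1| <= t ->
  `|p * z - 1| <= t + e *+ 2.
Proof.
move=> t1 pe zt.
have -> : p * z - 1 = (p - 1) * z + (z - 1) by ring.
rewrite (le_trans (ler_normD _ _))// addrC lerD// normrM.
rewrite -mulr_natr ler_pM//.
rewrite -[z](subrK 1) (le_trans (ler_normD _ _))// normr1.
by rewrite [leRHS](_ : _ = 1 + 1)// lerD2r (le_trans zt).
Qed.

Lemma expr_mul_near1 k p z e t : 0 <= e -> t + e *+ 2 *+ k <= 1 ->
  `|p - 1| <= e -> `|z - 1| <= t -> `|p ^+ k * z - 1| <= t + e *+ 2 *+ k.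
Proof.
move=> e0 + pe zt; elim: k => [|k IH] tk1; first by rewrite expr0 mul1r addr0.
have tk : t + e *+ 2 *+ k <= 1.
  by apply: le_trans tk1; rewrite lerD2l [_ *+ k.+1]mulrSr lerDl mulrn_wge0.
by rewrite exprS -mulrA [_ *+ k.+1]mulrSr addrA mul_near1// IH.
Qed.

(** In p^(n+1) - q^(n+1) = (p - q) S, each of the n + 1 terms of S is within 2 n e = n / (n + 1) < 1
    of 1, so S cannot vanish. *)
Lemma expr_inj_near1 n p q e : e = (2 * n.+1%:R)^-1 ->
  `|p - 1| <= e -> `|q - 1| <= e -> p ^+ n.+1 = q ^+ n.+1 -> p = q.
Proof.
move=> eE pe qe /eqP; rewrite -subr_eq0 subrXX mulf_eq0 => /orP[|/eqP S0].
  by rewrite subr_eq0 => /eqP.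
have e0 : 0 <= e by rewrite eE invr_ge0 mulr_ge0.
have en : e *+ 2 *+ n = n%:R / n.+1%:R.
  by rewrite -(mulr_natr _ n) -(mulr_natr e 2) eE; field; rewrite ?pnatr_eq0.
have en1 : e *+ 2 *+ n < 1 by rewrite en ltr_pdivrMr// mul1r ltr_nat.
have term (i : 'I_n.+1) : `|p ^+ (n.+1.-1 - i) * q ^+ i - 1| <= e *+ 2 *+ n.
  have /= := ltn_ord i; rewrite ltnS => ilen.
  have -> : e *+ 2 *+ n = e *+ 2 *+ i + e *+ 2 *+ (n - i).
    by rewrite -mulrnDr subnKC.
  have ni : e *+ 2 *+ i + e *+ 2 *+ (n - i) <= 1.
    by rewrite -mulrnDr subnKC// ltW.
  (* First the n - i factors p are split off, with z = q^i and t = 2 e i; then the i factors q,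
     starting from z = 1 and t = 0. *)
  apply: expr_mul_near1 => //.
  rewrite -[q ^+ i]mulr1 -[leRHS]add0r; apply: expr_mul_near1 => //.
    by rewrite add0r (le_trans _ ni)// lerDl !mulrn_wge0.
  by rewrite subrr normr0.
have : `|\sum_(i < n.+1) (p ^+ (n.+1.-1 - i) * q ^+ i - 1)| < n.+1%:R.
  apply: le_lt_trans (ler_norm_sum _ _ _) _.
  apply: (@le_lt_trans _ _ (\sum_(i < n.+1) e *+ 2 *+ n)).
    by apply: ler_sum => i _; exact: term.
  by rewrite sumr_const card_ord -[X in X < _]mulr_natr gtr_pMl.
(* If S = 0, the sum of the deviations from 1 is -(n + 1), of norm exactly n + 1. *)
by rewrite sumrB S0 sumr_const card_ord sub0r normrN normr_nat ltxx.
Qed.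

End power_injectivity.

(** * Sequences as nets, and convergence of the relevant series *)

Section sequences_and_nets.
Context {R : realType}.
Local Notation C := R[i].
Local Notation l2 := (ell2 R).

Lemma cvg_tails (u : C^nat) (l : C) :
  u @ \oo --> l -> u @ tails (fun m n => (m <= n)%N) --> l.
Proof. by move=> ul A /ul[n _ uA]; exists n => m nm; exact: uA. Qed.

Lemma directed_leq : directed (fun m n => (m <= n)%N).
Proof.
split=> [|//|a b c|a b]; first exact: (inhabits 0%N).
  exact: leq_trans.
by exists (maxn a b); rewrite ?leq_maxl ?leq_maxr.
Qed.

Lemma lim_series_finite (a : C^nat) n :
  (forall j, (n <= j)%N -> a j = 0) -> limn (series a) = series a n.
Proof.
move=> a0; apply/cvg_lim => //; apply: cvg_near_cst; exists n => // m /= nm.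
rewrite /series/= (big_cat_nat _ nm)//= [X in _ + X]big_nat_cond.
rewrite [X in _ + X]big1 ?addr0//.
by move=> j /andP[/andP[/a0]].
Qed.

(** The terms |x_n|^2 of a convergent series tend to 0. This amounts to weak convergence of the unit
    vectors to 0. *)
Lemma coord_cvg0 (x : l2) : (fun n => x n) @ \oo --> (0 : C).
Proof.
have := cvg_series_cvg_0 (@ell2_cvg _ x) => x0.
apply/cvgr0Pnorm_lt => e e0.
have er : e = (complex.Re e)%:C by rewrite RRe_real// gtr0_real.
have e1 : 0 < complex.Re e by rewrite -ltcR -er.
have [n _ xn] := @cvgr0_norm_lt _ _ _ _ _ _ x0 _ (exprn_gt0 2 e1).
exists n => // m /xn /=; rewrite ger0_norm ?sqr_ge0//.
rewrite ltr_sqr ?nnegrE ?rnorm_ge0 ?ltW//.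
by rewrite er -rnormE ltcR.
Qed.

Lemma inner_series_cvg (x y : l2) :
  series (fun j => x j * (y j)^*) @ \oo --> inner x y.
Proof.
have [] // := @dominated_series _ (fun j => x j * (y j)^*)
  (fun j => rnorm (x j) * rnorm (y j)) (rnorm x * rnorm y).
  by move=> j; rewrite rnormM [rnorm (y j)^*]/rnorm normcJ.
exact: cauchy_schwarz.
Qed.

Lemma power_sum_series_cvg k (x : l2) :
  series (fun j => x j ^+ k.+2) @ \oo --> power_sum k.+2 x.
Proof.
rewrite (_ : (fun j => _) = fun j => ppow k x j * x j).
  by rewrite power_sumE; exact: (dot_cvg_le _ _).1.
by apply/funext => j; rewrite ppowE -exprSr.
Qed.

End sequences_and_nets.

(** * Truncated sequences with a bump in the next coordinate *)

Section truncation.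
Context {R : realType}.
Local Notation C := R[i].
Local Notation l2 := (ell2 R).
Implicit Types x y : l2.

Lemma sq_series_trunc_le n x m :
  sq_series (fun j => if (j < n)%N then x j else 0) m <= rnorm x ^+ 2.
Proof.
apply: le_trans (sq_series_le_rnorm x m); apply: ler_sum => j _.
by case: ifP => // _; rewrite rnorm0 expr0n sqr_ge0.
Qed.

Definition trunc n x : l2 := Ell2 (ell2_pred_le (sq_series_trunc_le n x)).

Lemma trunc_le n x : rnorm (trunc n x) <= rnorm x.
Proof.
by apply: rnorm_ell2_le; [exact: rnorm_ge0|exact: sq_series_trunc_le].
Qed.

Lemma trunc_linear n : linear (trunc n).
Proof.
move=> a x y; apply/val_inj/funext => j.
rewrite [RHS](_ : _ = a * trunc n x j + trunc n y j)//=.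
by case: ifP => // _; rewrite mulr0 addr0.
Qed.

Lemma trunc_differentiable n x : differentiable (trunc n) x.
Proof.
apply: (@bounded_linear_differentiable _ _ _ _ 1) => //.
  exact: trunc_linear.
by move=> u; rewrite mul1r -!rnormE lecR trunc_le.
Qed.

Lemma sq_series_unit_vec_le n m :
  sq_series (fun j => (j == n)%:R : C) m <= 1 ^+ 2.
Proof.
rewrite /sq_series /series/= expr1n.
have [nm|mn] := ltnP n m.
  rewrite (bigD1_seq n) ?mem_index_iota ?iota_uniq//= eqxx /rnorm normr1 expr1n.
  by rewrite big1 ?addr0// => j /negbTE->; rewrite normr0 expr0n.
rewrite big_nat_cond big1 // => j /andP[/andP[_ jm] _].
by rewrite ltn_eqF ?(leq_trans jm)// rnorm0 expr0n.
Qed.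

Definition unit_vec n : l2 := Ell2 (ell2_pred_le (sq_series_unit_vec_le n)).

Lemma unit_vec_le1 n : rnorm (unit_vec n) <= 1.
Proof. by apply: rnorm_ell2_le => //; exact: sq_series_unit_vec_le. Qed.

Lemma trunc_unitE n x (a : C) j :
  ell2_seq (trunc n x + a *: unit_vec n) j =
  if (j < n)%N then x j else if j == n then a else 0.
Proof.
rewrite [LHS](_ : _ = trunc n x j + a * unit_vec n j)//=.
by case: ltngtP => _; rewrite ?mulr0 ?mulr1 ?addr0 ?add0r.
Qed.

(** Truncation keeps the coordinates below n, so slot n is free for the bump and all terms from n +
    1 on vanish. The general [f] serves both power sums and inner products. *)
Lemma lim_series_trunc_unit (f : nat -> C -> C) n x (a : C) :
  (forall j, f j 0 = 0) ->
  limn (series (fun j => f j (ell2_seq (trunc n x + a *: unit_vec n) j))) =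
  series (fun j => f j (x j)) n + f n a.
Proof.
move=> f0; rewrite (@lim_series_finite _ _ n.+1).
  rewrite seriesSr trunc_unitE ltnn eqxx; congr (_ + _).
  by apply: eq_big_nat => j /andP[_ jn]; rewrite trunc_unitE jn.
by move=> j nj; rewrite trunc_unitE ltnNge (ltnW nj)/= gtn_eqF.
Qed.

Lemma power_sum_trunc_unit k n x (a : C) :
  power_sum k.+2 (trunc n x + a *: unit_vec n) =
  series (fun j => x j ^+ k.+2) n + a ^+ k.+2.
Proof.
rewrite /power_sum (lim_series_trunc_unit (f := fun _ z => z ^+ k.+2))// => j.
by rewrite expr0n.
Qed.

Lemma inner_trunc_unit n x y (a : C) :
  inner (trunc n x + a *: unit_vec n) y =
  series (fun j => x j * (y j)^*) n + a * (y n)^*.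
Proof.
rewrite /inner (lim_series_trunc_unit (f := fun j z => z * (y j)^*))// => j.
by rewrite mul0r.
Qed.

End truncation.

(** * Differentiability of products, powers and affine expressions *)

Section complex_differentiability.
Context {R : realType}.
Local Notation C := R[i].
Context {E V : normedModType C}.

Lemma scale_differentiable (f : E -> C) (h : E -> V) (x : E) :
  differentiable f x -> differentiable h x ->
  differentiable (fun y => f y *: h y) x.
Proof.
apply: (@bounded_bilinear_differentiable C E C V V _ 1) => //.
- by move=> v a b d; rewrite scalerDl scalerA.
- by move=> a b u v; rewrite scalerDr !scalerA mulrC.
- by move=> a v; rewrite mul1r normrZ.
Qed.

Lemma mul_differentiable (f h : E -> C) (x : E) :
  differentiable f x -> differentiable h x ->
  differentiable (fun y => f y * h y) x.
Proof.
apply: (@bounded_bilinear_differentiable C E C C C _ 1) => //.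
- by move=> v a b d; rewrite mulrDl -mulrA.
- by move=> a b u v; rewrite mulrDr mulrCA.
- by move=> a v; rewrite mul1r normrM.
Qed.

Lemma expr_differentiable (f : E -> C) n (x : E) :
  differentiable f x -> differentiable (fun y => f y ^+ n) x.
Proof.
move=> df; elim: n => [|n IH]; first exact: differentiable_cst.
rewrite (_ : (fun y => _) = fun y => f y * f y ^+ n).
  exact: mul_differentiable.
by apply/funext => y; rewrite exprS.
Qed.

Lemma affine_differentiable (a b : C) (f : E -> C) (x : E) :
  differentiable f x -> differentiable (fun y => a * (1 + b * f y)) x.
Proof.
move=> df; apply: (mul_differentiable (differentiable_cst a x)).
have d1 : differentiable (cst 1 : E -> C) x by exact: differentiable_cst.
have d2 : differentiable (fun y => b * f y) x.
  exact: (mul_differentiable (differentiable_cst b x)).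
exact: differentiableD d1 d2.
Qed.

End complex_differentiability.

(** * Building elements of [Hinf] by extension by zero *)

Section Hinf_construction.
Context {R : realType}.
Local Notation C := R[i].

Definition zero_off_ball (E V : normedModType C) (f : E -> V) : E -> V :=
  fun x => if `|x| < 1 then f x else 0.

(** The ball is open, so near each of its points the extension agrees with [f]. *)
Lemma zero_off_ball_Hinf (E V : normedModType C) (f : E -> V) :
  holomorphic_on (unit_ball E) f -> bounded_on_ball f ->
  zero_off_ball f \in @Hinf_pred R E V.
Proof.
move=> hf [M fM]; apply/asboolP; split.
- move=> x Bx; apply: near_eq_differentiable (hf x Bx).
  have : \forall y \near x, `|y| < 1.
    apply: (@cvgr_norm_lt _ _ _ _ _ id x) => //; exact: cvg_id.
  by apply: filterS => y; rewrite /zero_off_ball => ->.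
- by exists M => x Bx; rewrite /zero_off_ball ifT// fM.
- by move=> x; rewrite /zero_off_ball; case: ifP.
Qed.

Lemma Hinf_le_norm (E V : normedModType C) (f : Hinf E V) x :
  unit_ball E x -> rnorm (f x) <= rnorm f.
Proof. exact: Hinf_le_sup. Qed.

Lemma Hinf_norm_le (E V : normedModType C) (f : Hinf E V) (M : R) :
  (forall x, unit_ball E x -> rnorm (f x) <= M) -> rnorm f <= M.
Proof. exact: Hinf_sup_le. Qed.

Lemma Hinf_differentiable (E V : normedModType C) (f : Hinf E V) x :
  unit_ball E x -> differentiable f x.
Proof. by case: f => f fP; have /asboolP[hf _ _] := fP; exact: hf. Qed.

Lemma Hinf_off_ball (E V : normedModType C) (f : Hinf E V) x :
  ~ unit_ball E x -> f x = 0.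
Proof. by case: f => f fP; have /asboolP[_ _ f0] := fP; exact: f0. Qed.

(** Evaluation at a point of the ball is linear of norm at most 1; this is the source of analyticity
    in u. *)
Lemma Hinf_eval_differentiable (E V : normedModType C) x (f : Hinf E V) :
  unit_ball E x -> differentiable (fun u : Hinf E V => u x) f.
Proof.
move=> Bx; apply: (@bounded_linear_differentiable _ _ _ _ 1) => // u.
by rewrite mul1r -!rnormE lecR Hinf_le_norm.
Qed.

End Hinf_construction.

(** * The perturbed maps and the analytic copy *)

Section analytic_copy.
Context {R : realType} (k : nat) (g : Hinf (ell2 R) (ell2 R)).
Context (g1 : rnorm g < 1).
Local Notation C := R[i].
Local Notation l2 := (ell2 R).
Local Notation X := (Hinf l2 C).
Implicit Types u : X.

Let e : R := (2 * k.+2%:R)^-1.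
Let c : R := (1 - rnorm g) / 4.

Let c_gt0 : 0 < c. Proof. by rewrite divr_gt0// subr_gt0. Qed.
Let e_gt0 : 0 < e. Proof. by rewrite invr_gt0 mulr_gt0. Qed.
Let e_le1 : e <= 1.
Proof. by rewrite invf_le1 ?mulr_gt0// -natrM ler1n. Qed.

(** [wave], [value] and [perturbed] are the w, F(u) and G_n of the overview, before extension by
    zero. *)
Let wave u (y : l2) : C := c%:C * (1 + e%:C * u y).

Let value u : l2 -> C := fun y => power_sum k.+2 (g y) + wave u y ^+ k.+2.

Let perturbed n u : l2 -> l2 := fun y => trunc n (g y) + wave u y *: unit_vec n.

Let rnorm_real (a : R) : 0 <= a -> rnorm (a%:C : C) = a.
Proof. by move=> a0; rewrite /rnorm ger0_norm ?ler0c. Qed.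

(** The bound covers every u, since F must take values in [Hinf] on the whole space and not only on
    the unit ball. *)
Let wave_le u y : unit_ball l2 y -> rnorm (wave u y) <= c * (1 + rnorm u).
Proof.
move=> By; rewrite rnormM rnorm_real ?(ltW c_gt0)// ler_wpM2l ?(ltW c_gt0)//.
rewrite (le_trans (ler_rnormD _ _))// rnorm_real// lerD2l.
rewrite rnormM rnorm_real ?(ltW e_gt0)//.
rewrite (le_trans (ler_wpM2l (ltW e_gt0) (Hinf_le_norm _ By)))//.
by rewrite ler_piMl ?rnorm_ge0.
Qed.

Let g_le1 y : unit_ball l2 y -> rnorm (g y) <= 1.
Proof. by move=> By; rewrite (le_trans (Hinf_le_norm _ By))// ltW. Qed.

Let wave_differentiable u y : unit_ball l2 y -> differentiable (wave u) y.
Proof.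
by move=> By; apply: affine_differentiable; exact: Hinf_differentiable.
Qed.

Let value_Hinf u : zero_off_ball (value u) \in @Hinf_pred R l2 C.
Proof.
apply: zero_off_ball_Hinf => [y By|].
  apply: differentiableD; last exact/expr_differentiable/wave_differentiable.
  apply: (@differentiable_comp _ _ _ _ g); first exact: Hinf_differentiable.
  exact: power_sum_differentiable.
exists (1 + (c * (1 + rnorm u)) ^+ k.+2) => y By; rewrite /value.
rewrite (le_trans (ler_rnormD _ _))// lerD ?power_sum_le1 ?g_le1//.
rewrite rnormX lerXn2r ?nnegrE ?rnorm_ge0 ?wave_le//.
by rewrite mulr_ge0 ?addr_ge0 ?rnorm_ge0 ?(ltW c_gt0).
Qed.

Let perturbed_le n u y : unit_ball l2 y ->
  rnorm (perturbed n u y) <= rnorm g + c * (1 + rnorm u).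
Proof.
move=> By; apply: le_trans (ler_rnormD _ _) _; apply: lerD.
  exact: le_trans (trunc_le n _) (Hinf_le_norm g By).
rewrite rnormZ; apply: le_trans (wave_le u By).
exact: ler_piMr (rnorm_ge0 _) (unit_vec_le1 n).
Qed.

Let perturbed_Hinf n u : zero_off_ball (perturbed n u) \in @Hinf_pred R l2 l2.
Proof.
apply: zero_off_ball_Hinf => [y By|].
  apply: differentiableD.
    apply: (@differentiable_comp _ _ _ _ g); first exact: Hinf_differentiable.
    exact: trunc_differentiable.
  apply: (scale_differentiable (wave_differentiable u By)).
  exact: differentiable_cst.
by exists (rnorm g + c * (1 + rnorm u)) => y; exact: perturbed_le.
Qed.

Lemma analytic_copy_exists :
  contains_analytic_copy (unit_ball X) (vector_cluster_set (power_sum k.+2) g).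
Proof.
exists (fun u => MkHinf (value_Hinf u)); split.
- move=> u v; rewrite !inE => /unit_ballP u1 /unit_ballP v1.
  move=> /(congr1 (@Hinf_fun _ _ _)) uv.
  apply/val_inj/funext => y.
  have [By|By] := pselect (unit_ball l2 y); last by rewrite /= !Hinf_off_ball.
  have close (w : X) : rnorm w < 1 -> `|1 + e%:C * w y - 1| <= e%:C.
    move=> w1; rewrite addrC addKr -rnormE lecR.
    rewrite rnormM rnorm_real ?(ltW e_gt0)//.
    by rewrite ler_piMr ?(ltW e_gt0)// (le_trans (Hinf_le_norm _ By))// ltW.
  have c0 : c%:C != 0 :> C by rewrite (inj_eq (@complexI _)) gt_eqF.
  have e0 : e%:C != 0 :> C by rewrite (inj_eq (@complexI _)) gt_eqF.
  have eE : e%:C = (2 * k.+2%:R)^-1 :> C by rewrite fmorphV rmorphM !rmorph_nat.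
  (* At y the common term f_0(g(y)) cancels, then the power of c; injectivity of the power near 1
     leaves 1 + e u(y) = 1 + e v(y). *)
  have := congr1 (@^~ y) uv; rewrite /= /zero_off_ball !ifT// /value => /addrI.
  rewrite !exprMn => /(mulfI (expf_neq0 _ c0)).
  move=> /(expr_inj_near1 eE (close u u1) (close v v1)).
  by move=> /addrI /(mulfI e0).
- move=> _ [u /unit_ballP u1 <-].
  exists nat, (fun m n => (m <= n)%N), (fun n => MkHinf (perturbed_Hinf n u)).
  split; first exact: directed_leq.
  + move=> n; rewrite -rnormE ltcR.
    (* The norm is a supremum, so a bound uniform in y is needed: |g| + 2 c = (1 + |g|) / 2. *)
    apply: (@le_lt_trans _ _ ((1 + rnorm g) / 2)); last by move: g1; lra.
    apply: Hinf_norm_le => y By; rewrite /= /zero_off_ball ifT//.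
    apply: le_trans (perturbed_le n u By) _.
    apply: (@le_trans _ _ (rnorm g + c * 2)); last by rewrite /c; lra.
    by rewrite lerD2l ler_wpM2l ?(ltW c_gt0)//; lra.
  + move=> y v By; apply: cvg_tails.
    (* A partial sum of the inner product of g(y) and v, plus w(y) times the conjugate of v_n, which
       tends to 0. *)
    under eq_fun do rewrite /= /zero_off_ball ifT// inner_trunc_unit.
    rewrite -[inner _ _]addr0; apply: cvgD; first exact: inner_series_cvg.
    rewrite -(mulr0 (wave u y)); apply: cvgMr.
    apply/cvgr0Pnorm_lt => d d0.
    under eq_near do rewrite normcJ.
    exact: (@cvgr0_norm_lt _ _ _ _ _ _ (coord_cvg0 v)).
  + move=> y By; apply: cvg_tails.
    (* The bump contributes the same w(y)^(k+2) for every n, so it survives in the limit. *)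
    under eq_fun do rewrite /= /zero_off_ball ifT// power_sum_trunc_unit.
    rewrite /= /zero_off_ball ifT//; apply: cvgD; last exact: cvg_cst.
    exact: power_sum_series_cvg.
- move=> y By u _; rewrite /= /zero_off_ball By.
  (* For fixed y the term f_0(g(y)) is constant in u, and the rest is a polynomial in the evaluation
     u(y). *)
  apply: (differentiableD (differentiable_cst _ u)).
  apply/expr_differentiable/affine_differentiable.
  exact: Hinf_eval_differentiable.
Qed.

End analytic_copy.

Theorem proposition3p3 (R : realType) (N : nat) (hN : (2 <= N)%N) :
  Au (@power_sum R N) /\
  forall g : Hinf (ell2 R) (ell2 R), (`|g| < 1)%R ->
    contains_analytic_copy (unit_ball (Hinf (ell2 R) R[i]))
      (vector_cluster_set (power_sum N) g).
Proof.
case: N hN => [|[|k]]// _; split=> [|g g1]; first exact: power_sum_Au.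
by apply: analytic_copy_exists; rewrite -ltcR rnormE.
Qed.
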